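(* Let $X$ be a compact metrizable space, let $C_1(X)=\{x\in X : \{x\}\text{ is a connected component of }X\}$, and suppose that $C_1(X)$ forms a dense $G_\delta$ subset of $X$ with non-empty interior. Let $C$ denote the Cantor set and $0\in C$ a point. The following are equivalent: (1) $X$ is not reconstructible; (2) $X$ has a constant universal sequence (of type $\langle C\rangle$); (3) the interior of $C_1(X)$ contains no isolated points and is dense in $X$; (4) $X$ is a compactification of $C\setminus\{0\}$.
   Context: For a topological space $X$, $[Y]$ denotes the homeomorphism class of $Y$, and the deck of $X$ is the set $\mathcal{D}(X)=\{[X\setminus\{x\}] : x\in X\}$. The space $X$ is reconstructible if every topological space $Z$ with $\mathcal{D}(Z)=\mathcal{D}(X)$ is homeomorphic to $X$. A $G_\delta$ set is a countable intersection of open sets. A sequence $\langle B_n : n\in\mathbb{N}\rangle$ of subsets of $X$ converges to a point $x$ if for every neighbourhood $U$ of $x$ there is $N\in\mathbb{N}$ such that $B_n\subseteq U$ for all $n\ge N$. The space $X$ has a constant universal sequence of type $\langle C\rangle$ if for every $x\in X$ there is a sequence of pairwise disjoint clopen subsets of $X$, each homeomorphic to $C$, converging to $x$. $X$ is a compactification of $Y$ if $X$ is compact Hausdorff and contains a dense subspace homeomorphic to $Y$.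
   Formalization: The formal theorem additionally assumes that X does not have exactly two points; the two-point discrete space is a counterexample, since it shares its deck with the two-point indiscrete space (so (1) holds) while (2), (3) and (4) fail. *)

(* Defs.v *)
From mathcomp Require Import all_boot.
From mathcomp Require Import boolp classical_sets functions.
From mathcomp Require Import reals topology borel_hierarchy cantor.

Set Implicit Arguments.
Unset Strict Implicit.
Unset Printing Implicit Defensive.

Local Open Scope classical_set_scope.

(* A set [A : set X] used as a type is the subtype [{x | x \in A}] with the
   topology induced by X.  This is not [subspace A], which is a topology on the
   whole of X. *)

Definition homeomorphic (X Y : topologicalType) : Prop :=
  exists (f : X -> Y) (g : Y -> X),
    [/\ continuous f, continuous g, cancel f g & cancel g f].

(* Spelled with [_ -> Prop] because [set topologicalType] is a universe
   inconsistency. *)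
Definition homeo_class (Y : topologicalType) : topologicalType -> Prop :=
  fun Z => homeomorphic Y Z.

Definition deck (X : topologicalType) : (topologicalType -> Prop) -> Prop :=
  fun K => exists x : X, K = homeo_class [set~ x].

Definition reconstructible (X : topologicalType) : Prop :=
  forall Z : topologicalType, deck Z = deck X -> homeomorphic Z X.

Definition metrizable (R : realType) (X : topologicalType) : Prop :=
  exists M : metricType R, homeomorphic X M.

Definition one_point_components (X : topologicalType) : set X :=
  [set x | connected_component [set: X] x = [set x]].
Arguments one_point_components X : clear implicits.

Definition sets_converge_to (X : topologicalType) (B : nat -> set X) (x : X) :
    Prop :=
  forall U : set X, nbhs x U -> \forall n \near \oo, B n `<=` U.

Definition constant_universal_sequence (C X : topologicalType) : Prop :=
  forall x : X, exists B : nat -> set X,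
    [/\ trivIset [set: nat] B,
        forall n, clopen (B n),
        forall n, homeomorphic (B n) C
      & sets_converge_to B x].

Definition compactification_of (X Y : topologicalType) : Prop :=
  [/\ compact [set: X],
      hausdorff_space X
    & exists D : set X, dense D /\ homeomorphic D Y].

(* Main.v *)
Require Import Defs.
From HB Require Import structures.
From mathcomp Require Import all_boot all_order all_algebra.
From mathcomp Require Import boolp classical_sets functions cardinality.
From mathcomp Require Import reals topology borel_hierarchy cantor.

(** Write [U] for the interior of the set of one-point components of [X].
    Everything rests on two facts about [U] when [X] has no isolated points.
    A point of [U] has arbitrarily small clopen neighbourhoods inside [U], and
    these are Cantor sets by Brouwer's characterisation
    ([clopen_nbhs_one_point], [clopen_homeomorphic_cantor]).  Hence
    - every point in the closure of an open [Q] contained in [U], but not in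
      [Q], is the limit of disjoint clopen Cantor sets taken inside [Q]
      ([cantor_sets_converging]);
    - an open subset of [U] that is not closed in [X] splits into infinitely
      many clopen Cantor sets, so that all such sets, in whatever space, are
      homeomorphic to each other and to the Cantor set minus a point
      ([homeo_on_noncompact_cantor]).

    By the second fact a dense [U] makes [X] a compactification: [U] minus a
    point is dense in [X] and homeomorphic to the punctured Cantor set.
    Conversely the members of a universal sequence, and the compact clopen
    pieces of a dense punctured Cantor set, are clopen in [X], so they lie in
    [U].

    When [U] is dense, deleting a point [x0] of [U] from a card changes nothing
    up to homeomorphism: Cantor sets converging to the missing point [y], which
    exist by the first fact, form, together with a Cantor neighbourhood of [x0],
    an open noncompact subset of [U], which absorbs the loss of [x0] by the
    second fact ([homeo_on_card_remove]).  So [X] minus [x0] has the same deck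
    as [X] without being compact, and [X] is not reconstructible.

    The remaining direction starts from a space [Z] with the deck of [X] that is
    not homeomorphic to [X].  It is Hausdorff because its cards are
    ([hausdorff_deck]); this is where two-point spaces have to be excluded.
    Since a compact Hausdorff space is determined by any of its cards (it is the
    one-point compactification), [Z] is not compact.  This already forbids
    isolated points in [X], as removing one leaves a compact card, and adding a
    point to it cannot give a noncompact space.  Take [x] in [U] and a card of
    [Z], missing [z], that is homeomorphic to [X] minus [x].  The part of [Z]
    outside a compact neighbourhood of [z] is not relatively compact, so in [X]
    it accumulates at [x], where it consists of points of [U].  The first fact,
    applied there, yields infinitely many disjoint compact open Cantor sets in
    [Z] that form a locally finite family.  Local finiteness survives the
    deletion of any point of [Z], so for every [y] the family reappears in the
    card [X] minus [y]; by compactness of [X] it has to converge to [y], which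
    gives the universal sequence
    ([not_reconstructible_constant_universal_sequence]). *)

Set Implicit Arguments.
Unset Strict Implicit.
Unset Printing Implicit Defensive.

Import Order.TTheory GRing.Theory Num.Theory.
Local Open Scope classical_set_scope.

(** * Homeomorphisms between open subsets *)

(** Subsets are matched by total functions, so that pieces of a partition can be
    glued and composed without transport between subtypes.  Continuity is asked
    at the points of [A] for the topology of the whole space, which agrees with
    continuity of the restriction because [A] will always be open. *)
Definition inverse_on (X Y : topologicalType) (A : set X) (B : set Y)
    (f : X -> Y) (g : Y -> X) : Prop :=
  forall x, A x -> [/\ B (f x), g (f x) = x & {for x, continuous f}].

Definition homeo_on (X Y : topologicalType) (A : set X) (B : set Y) : Prop :=
  exists f g, inverse_on A B f g /\ inverse_on B A g f.

Lemma homeo_on_refl (X : topologicalType) (A : set X) : homeo_on A A.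
Proof. by exists id, id; split=> x Ax; split=> //; exact: cvg_id. Qed.

Lemma homeo_on_sym (X Y : topologicalType) (A : set X) (B : set Y) :
  homeo_on A B -> homeo_on B A.
Proof. by move=> [f [g [fP gP]]]; exists g, f. Qed.

Lemma homeo_on_trans (X Y Z : topologicalType) (A : set X) (B : set Y)
    (C : set Z) :
  homeo_on A B -> homeo_on B C -> homeo_on A C.
Proof.
move=> [f [f' [fP f'P]]] [g [g' [gP g'P]]].
exists (g \o f), (f' \o g'); split=> [x Ax|z Cz].
  have [Bf ff cf] := fP x Ax; have [Cg gg cg] := gP _ Bf.
  by split=> //=; [rewrite gg ff | exact: continuous_comp].
have [Bg gg cg] := g'P z Cz; have [Af ff cf] := f'P _ Bg.
by split=> //=; [rewrite ff gg | exact: continuous_comp].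
Qed.

Lemma open_set_type (X : topologicalType) (A : set X) (U : set A) :
  open U <-> exists2 V : set X, open V & U = val @^-1` V.
Proof.
split=> [[V oV <-]|[V oV ->]]; exists V => //.
Qed.

Lemma continuous_val (X : topologicalType) (A : set X) :
  continuous (val : A -> X).
Proof. exact: (@initial_continuous A X set_val). Qed.

Lemma continuous_to_set_type (X Y : topologicalType) (B : set Y)
    (f : X -> B) (x : X) :
  {for x, continuous (val \o f)} -> {for x, continuous f}.
Proof.
move=> cf U [_ [[W oW <-]] /= Wfx /filterS]; apply; apply: cf.
exact: open_nbhs_nbhs.
Qed.

Lemma homeo_on_homeomorphic (X Y : topologicalType) (A : set X) (B : set Y) :
  homeo_on A B -> homeomorphic A B.
Proof.
move=> [f [g [fP gP]]].
have fB (a : A) : f (val a) \in B by apply/mem_set; case: (fP _ (set_valP a)).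
have gA (b : B) : g (val b) \in A by apply/mem_set; case: (gP _ (set_valP b)).
exists (fun a => SigSub (fB a)), (fun b => SigSub (gA b)); split.
- move=> a; apply: continuous_to_set_type.
  apply: continuous_comp; first exact: continuous_val.
  by case: (fP _ (set_valP a)).
- move=> b; apply: continuous_to_set_type.
  apply: continuous_comp; first exact: continuous_val.
  by case: (gP _ (set_valP b)).
- by move=> a; apply: val_inj; case: (fP _ (set_valP a)).
- by move=> b; apply: val_inj; case: (gP _ (set_valP b)).
Qed.

(** Only the source needs to be open; the target may be any subspace, which is
    what a dense subspace of a compactification requires. *)
Lemma homeomorphic_inverse_on (X Y : topologicalType) (A : set X) (B : set Y)
    (f : A -> B) (x0 : X) (y0 : Y) :
  open A -> continuous f ->
  forall (g : B -> A), cancel f g ->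
  inverse_on A B (fun x => if insub x is Some a then val (f a) else y0)
                 (fun y => if insub y is Some b then val (g b) else x0).
Proof.
move=> oA cf g fK x Ax.
have AxP : x \in A by exact: mem_set.
rewrite /= insubT; split.
- exact: set_valP.
- by rewrite valK fK.
- move=> U; rewrite /= insubT => /= nU.
  have := @continuous_comp _ _ _ f (val : B -> Y) (Sub x AxP) (cf _)
    (@continuous_val _ _ _) U nU.
  move=> [_ [[W oW <-]] /= Wx WU].
  have : nbhs x (W `&` A) by apply: open_nbhs_nbhs; split; [exact: openI|].
  apply: filterS => z [Wz /mem_set Az] /=; rewrite insubT.
  exact: WU.
Qed.

Lemma homeomorphic_homeo_on (X Y : topologicalType) (A : set X) (B : set Y)
    (x0 : X) (y0 : Y) :
  open A -> open B -> homeomorphic A B -> homeo_on A B.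
Proof.
move=> oA oB [f [g [cf cg fK gK]]].
by do 2!eexists; split; apply: homeomorphic_inverse_on; eauto.
Qed.

Lemma homeomorphic_sym (X Y : topologicalType) :
  homeomorphic X Y -> homeomorphic Y X.
Proof. by move=> [f [g [cf cg fK gK]]]; exists g, f. Qed.

Lemma homeomorphic_trans (X Y Z : topologicalType) :
  homeomorphic X Y -> homeomorphic Y Z -> homeomorphic X Z.
Proof.
move=> [f [f' [cf cf' fK f'K]]] [g [g' [cg cg' gK g'K]]].
exists (g \o f), (f' \o g'); split.
- by move=> x; apply: continuous_comp; [exact: cf|exact: cg].
- by move=> x; apply: continuous_comp; [exact: cg'|exact: cf'].
- exact: can_comp.
- exact: can_comp.
Qed.

Lemma homeomorphic_homeo_class (X Y : topologicalType) :
  homeomorphic X Y -> homeo_class X = homeo_class Y.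
Proof.
move=> XY; apply/funext => Z; apply/propext; split=> h.
  by apply: homeomorphic_trans h; exact: homeomorphic_sym.
exact: homeomorphic_trans h.
Qed.

Lemma homeo_class_inj (X Y : topologicalType) :
  homeo_class X = homeo_class Y -> homeomorphic X Y.
Proof.
move=> XY; change (homeo_class X Y); rewrite XY.
by exists id, id; split=> // x; exact: cvg_id.
Qed.

Lemma homeomorphic_setT (X : topologicalType) : homeomorphic X [set: X].
Proof.
have IX (x : X) : x \in [set: X] by exact: mem_set.
exists (fun x => SigSub (IX x)), val; split.
- by move=> x; apply: continuous_to_set_type; exact: cvg_id.
- exact: continuous_val.
- by [].
- by move=> a; apply: val_inj.
Qed.

Lemma homeo_on_setT (X Y : topologicalType) (A : set X) (x0 : X) (y0 : Y) :
  open A -> homeomorphic A Y <-> homeo_on A [set: Y].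
Proof.
move=> oA; split=> h.
  apply: homeomorphic_homeo_on => //; first exact: openT.
  by apply: homeomorphic_trans h (homeomorphic_setT Y).
apply: homeomorphic_trans (homeo_on_homeomorphic h) _.
exact/homeomorphic_sym/homeomorphic_setT.
Qed.

Lemma inverse_on_image_open (X Y : topologicalType) (A : set X) (B : set Y) f g
    (A' : set X) :
  inverse_on A B f g -> inverse_on B A g f -> open B -> open A' -> A' `<=` A ->
  open (f @` A').
Proof.
move=> fP gP oB oA' A'A; rewrite openE => _ [x A'x <-].
have [Bfx gfx _] := fP x (A'A x A'x); have [_ _ cg] := gP _ Bfx.
have nA' : nbhs (g (f x)) A' by rewrite gfx; apply: open_nbhs_nbhs.
have nB : nbhs (f x) B by exact: open_nbhs_nbhs.
apply: filterS (filterI nB (cg _ nA')) => y [By A'gy].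
by exists (g y) => //; case: (gP y By).
Qed.

Lemma inverse_on_image_compact (X Y : topologicalType) (A : set X) (B : set Y)
    f g (K : set X) :
  inverse_on A B f g -> compact K -> K `<=` A -> compact (f @` K).
Proof.
move=> fP cK KA; apply: continuous_compact => //.
apply: continuous_in_subspaceT => x /set_mem /KA Ax.
by case: (fP x Ax).
Qed.

Lemma inverse_on_sub (X Y : topologicalType) (A : set X) (B : set Y) f g
    (A' : set X) :
  inverse_on A B f g -> inverse_on B A g f -> A' `<=` A ->
  homeo_on A' (f @` A').
Proof.
move=> fP gP A'A; exists f, g; split=> [x A'x|_ [x A'x <-]].
  by have [? ? ?] := fP x (A'A x A'x); split=> //; exists x.
have [Bfx gfx _] := fP x (A'A x A'x); have [_ fgfx cg] := gP _ Bfx.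
by rewrite gfx; split=> //; rewrite ?gfx.
Qed.

(** The index of the piece containing a point is locally constant, so the
    maps can be chosen piece by piece.  The default index [i0] is the one used
    outside the union. *)
Lemma homeo_on_glue (X Y : topologicalType) (I : Type) (i0 : I)
    (P : I -> set X) (Q : I -> set Y) :
  trivIset setT P -> trivIset setT Q ->
  (forall i, open (P i)) -> (forall i, open (Q i)) ->
  (forall i, homeo_on (P i) (Q i)) ->
  homeo_on (\bigcup_i P i) (\bigcup_i Q i).
Proof.
move=> tP tQ oP oQ PQ.
pose idx (T : Type) (S : I -> set T) x :=
  if pselect (exists i, S i x) is left e then projT1 (cid e) else i0.
have idxE (T : Type) (S : I -> set T) i x :
    trivIset setT S -> S i x -> idx T S x = i.
  move=> tS Six; rewrite /idx; case: pselect => [e|[]]; last by exists i.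
  by apply: tS => //; exists x; split=> //; exact: (projT2 (cid e)).
have [f fP] := choice PQ; have [g gP] := choice fP.
exists (fun x => f (idx _ P x) x), (fun y => g (idx _ Q y) y).
have main (X' Y' : topologicalType) (P' : I -> set X') (Q' : I -> set Y')
    f' g' :
    trivIset setT P' -> trivIset setT Q' -> (forall i, open (P' i)) ->
    (forall i, inverse_on (P' i) (Q' i) (f' i) (g' i)) ->
    inverse_on (\bigcup_i P' i) (\bigcup_i Q' i)
      (fun x => f' (idx _ P' x) x) (fun y => g' (idx _ Q' y) y).
  move=> tP' tQ' oP' fgP x [i _ Pix].
  have [Qfx gfx cf] := fgP i x Pix.
  rewrite (idxE _ _ i x)//; split; first by exists i.
    by rewrite (idxE _ _ i (f' i x)).
  have nP : nbhs x (P' i) by exact: open_nbhs_nbhs.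
  move=> U; rewrite /= (idxE _ _ i x)// => /cf nU.
  by apply: filterS (filterI nP nU) => z [Piz]; rewrite /= (idxE _ _ i z).
by split; apply: main => // i; case: (gP i).
Qed.

Lemma homeomorphic_set_type_in (X : topologicalType) (A : set X) (B : set A) :
  homeomorphic B (val @` B).
Proof.
have vB (b : B) : val (val b) \in val @` B.
  by apply/mem_set; exists (val b) => //; exact: set_valP.
have Bv (y : val @` B) : exists a : A, B a /\ val a = val y.
  by have [a Ba <-] := set_valP y; exists a.
pose a y := projT1 (cid (Bv y)).
have aP y : a y \in B by apply/mem_set; exact: (projT2 (cid (Bv y))).1.
have aE y : val (a y) = val y by exact: (projT2 (cid (Bv y))).2.
exists (fun b => SigSub (vB b)), (fun y => SigSub (aP y)); split.
- move=> b; apply: continuous_to_set_type.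
  by apply: continuous_comp; exact: continuous_val.
- move=> y; do 2! apply: continuous_to_set_type.
  rewrite (_ : _ \o _ = val); first exact: continuous_val.
  by apply/funext => z /=; exact: aE.
- by move=> b; do 2!apply: val_inj; rewrite /= aE.
- by move=> y; apply: val_inj; rewrite /= aE.
Qed.

(** * Clopen neighbourhoods of one-point components *)

(** The clopen sets containing [q] are closed under finite intersections; if
    each of them met the compact complement of [W], so would their
    intersection. *)
Lemma nbhs_quasicomponent (X : topologicalType) (q : X) (W : set X) :
  compact [set: X] -> open W ->
  \bigcap_(D in [set D | clopen D /\ D q]) D `<=` W ->
  exists D, [/\ clopen D, D q & D `<=` W].
Proof.
move=> cX oW KW; apply: contrapT => nD.
pose base := [set D : set X | clopen D /\ D q].
pose F := filter_from base (fun D => D `\` W).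
have FF : ProperFilter F.
  apply: filter_from_proper => [|D [cD Dq]].
    apply: filter_from_filter.
      by exists setT; split=> //; exact: clopenT.
    move=> D E [cD Dq] [cE Eq]; exists (D `&` E).
      by split=> //; exact: clopenI.
    by move=> x [[? ?] ?].
  apply: contrapT => DW; apply: nD; exists D; split=> // x Dx.
  by apply: contrapT => Wx; apply: DW; exists x.
have clW : closed (~` W) by exact: open_closedC.
have cW : compact (~` W) by exact: (subclosed_compact clW cX).
have FW : F (~` W).
  by exists setT; [split=> //; exact: clopenT | move=> x []].
have [p [nWp Fp]] := cW F FF FW.
apply: nWp; apply: KW => D [[oD cD] Dq]; apply: (cD) => V Vp.
have FD : F D by exists D => // x [].
have [x [Dx Vx]] := Fp D V FD Vp.
by exists x.
Qed.

(** In a compact Hausdorff space quasicomponents are connected: separate the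
    two halves of a splitting by open sets; a clopen set inside their union can
    be cut along the splitting and stays clopen. *)
Lemma connected_quasicomponent (X : topologicalType) (q : X) :
  compact [set: X] -> hausdorff_space X ->
  connected (\bigcap_(D in [set D | clopen D /\ D q]) D).
Proof.
move=> cX hX; set K := \bigcap_(_ in _) _.
have Kq : K q by move=> D [].
have cK : closed K by apply: closed_bigI => D [[]].
(* In a splitting of [K] the part that misses [q] is empty. *)
have split_empty (E F : set X) : closed E -> closed F -> E `&` F = set0 ->
    K `<=` E `|` F -> E q -> forall x, K x -> ~ F x.
  move=> cE cF EF0 KEF Eq.
  have [|V /set_nbhsP[P [oP EP PV]] VF] := @compact_normal X hX cX E cE (~` F).
    apply/set_nbhsP; exists (~` F); split=> //; first exact: closed_openC.
    exact/disjoints_subset.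
  have PF : closure P `<=` ~` F by apply: subset_trans VF; exact: closureS.
  have [||D [[oD cD] Dq DPF]] :=
    @nbhs_quasicomponent X q (P `|` ~` closure P) cX.
  - by apply: openU => //; exact/closed_openC/closed_closure.
  - by move=> x /KEF[/EP|Fx]; [left|right=> /PF].
  have DP : clopen (D `&` P).
    split; first exact: openI.
    rewrite (_ : D `&` P = D `&` closure P).
      by apply: closedI => //; exact: closed_closure.
    apply/seteqP; split=> x [Dx Px]; split=> //; first exact: subset_closure.
    by case: (DPF x Dx) => // /(_ Px).
  move=> x /(_ (D `&` P))[|_ /subset_closure/PF//].
  by split=> //; split=> //; exact: EP.
move=> B [b Bb] [C oC BC] [C' cC' BC'].
have cB : closed B by rewrite BC'; exact: closedI.
have cKB : closed (K `&` ~` C) by apply: closedI => //; exact: open_closedC.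
have BKC : B `&` (K `&` ~` C) = set0.
  by rewrite BC -subset0 => x [[_ Cx] [_ /(_ Cx)]].
have KBC : K `<=` B `|` (K `&` ~` C).
  by move=> x Kx; have [Cx|Cx] := pselect (C x); [left; rewrite BC|right].
have BK : B `<=` K by rewrite BC; exact: subIsetl.
have [Bq|KCq] := KBC q Kq.
  apply/seteqP; split=> // x Kx.
  by have [//|KCx] := KBC x Kx; case: (split_empty _ _ cB cKB BKC KBC Bq x Kx).
exfalso; apply: (split_empty _ B cKB cB _ _ KCq b (BK b Bb)) => //.
  by rewrite setIC.
by move=> x /KBC; rewrite setUC.
Qed.

Lemma clopen_nbhs_one_point (X : topologicalType) (q : X) (O : set X) :
  compact [set: X] -> hausdorff_space X ->
  one_point_components X q -> nbhs q O ->
  exists D, [/\ clopen D, D q & D `<=` O].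
Proof.
move=> cX hX q1 /nbhs_interior; rewrite nbhsE => -[W [oW Wq] WO].
have [//|D [cD Dq DW]] := @nbhs_quasicomponent X q W cX oW; last first.
  exists D; split=> //; apply: subset_trans DW _; apply: subset_trans WO _.
  exact: interior_subset.
move=> x Kx; suff -> : x = q by [].
have : connected_component [set: X] q x.
  exists (\bigcap_(D in [set D | clopen D /\ D q]) D) => //; split=> //.
    by move=> D [].
  exact: connected_quasicomponent.
by rewrite q1.
Qed.

(** * Recognising Cantor sets *)

(** Brouwer's theorem only needs a pseudometric, and the Cantor space carries
    one directly; the Hausdorff property is assumed separately where it
    matters. *)
Definition pseudometrizable (R : realType) (X : topologicalType) : Prop :=
  exists M : pseudoMetricType R, homeomorphic X M.

(** The bijection given by Brouwer's theorem is continuous and closed, so its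
    inverse is continuous. *)
Lemma cantor_like_homeomorphic (R : realType) (T : pseudoPMetricType R) :
  cantor_like T -> homeomorphic T cantor_space.
Proof.
move=> /homeomorphism_cantor_like[f [cf clf]].
have fK x : f^-1%FUN (f x) = x by apply: funK; exact: mem_set.
have gK y : f (f^-1%FUN y) = y by apply: invK; exact: mem_set.
exists f^-1%FUN, f; split=> //.
apply/continuous_closedP => A /clf.
rewrite (_ : f @` A = f^-1%FUN @^-1` A)//.
apply/seteqP; split=> [_ [x Ax <-]|y Ay] /=; first by rewrite fK.
by exists (f^-1%FUN y).
Qed.

Lemma pseudometrizable_cantor (R : realType) :
  pseudometrizable R cantor_space.
Proof.
exists (tree_of (fun=> bool)); apply: homeomorphic_sym.
apply: (@cantor_like_homeomorphic R).
apply: (@cantor_like_finite_prod (fun=> bool)) => n.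
  exact: finite_finset.
by exists (true, false).
Qed.

Lemma compact_homeomorphic (X Y : topologicalType) :
  homeomorphic X Y -> compact [set: X] -> compact [set: Y].
Proof.
move=> [f [g [cf cg fK gK]]] cX.
rewrite (_ : [set: Y] = f @` setT); last first.
  by apply/seteqP; split=> // y _; exists (g y).
apply: continuous_compact => //; exact: continuous_subspaceT.
Qed.

Lemma hausdorff_homeomorphic (X Y : topologicalType) :
  homeomorphic X Y -> hausdorff_space X -> hausdorff_space Y.
Proof.
move=> [f [g [cf cg fK gK]]] hX y z yz.
apply: (can_inj gK); apply: hX => U V Uy Vz.
have nfy : nbhs y (f @` U).
  apply: (@filterS _ (nbhs y) _ (g @^-1` U)); last exact: cg.
  move=> t Ut; exists (g t) => //; exact: gK.
have nfz : nbhs z (f @` V).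
  apply: (@filterS _ (nbhs z) _ (g @^-1` V)); last exact: cg.
  move=> t Vt; exists (g t) => //; exact: gK.
have [_ [[u Uu <-] [v Vv fvu]]] := yz _ _ nfy nfz.
by exists u; split=> //; rewrite -(fK u) -fvu fK.
Qed.

(** The topology induced on [A] is the initial one for the map into a
    pseudometric space, so it inherits a pseudometric; the point [a] makes the
    space pointed, as Brouwer's theorem demands. *)
Lemma pseudometrizable_set_type (R : realType) (X : topologicalType) (A : set X)
    (a : A) : pseudometrizable R X ->
  exists T : pseudoPMetricType R, homeomorphic A T.
Proof.
move=> [M [f [g [cf cg fK gK]]]].
pose S := initial_topology (fun a : A => f (val a)).
pose T : pseudoPMetricType R := HB.pack S (isPointed.Build S a).
exists T, id, id; split=> //.
- apply: continuous_comp_initial => x.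
  apply: (@continuous_comp _ _ _ (val : A -> X) f); last exact: cf.
  exact: continuous_val.
- move=> x; apply: continuous_to_set_type.
  have -> : val \o (id : T -> A) = g \o (f \o val).
    by apply/funext => z /=; rewrite fK.
  apply: continuous_comp; last exact: cg.
  exact: (@initial_continuous A M (fun a : A => f (val a))).
Qed.

Lemma compact_set_type (X : topologicalType) (A : set X) :
  compact A -> compact [set: A].
Proof.
move=> cA F FF _.
have FA : (val @ F) A.
  by apply: (@filterS _ F _ setT); [move=> a _; exact: set_valP|exact: filterT].
have [p [Ap Fp]] := cA (val @ F) _ FA.
exists (SigSub (mem_set Ap)); split=> // U V FU [_ [[W oW <-] /= Wp WV]].
have FU' : (val @ F) (val @` U).
  by apply: (@filterS _ F _ U) => // u Uu; exists u.
have nW : nbhs p W by exact: open_nbhs_nbhs.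
have [_ [[u Uu <-] Wu]] := Fp _ _ FU' nW.
by exists u; split=> //; exact: WV.
Qed.

Lemma hausdorff_inj (X Y : topologicalType) (f : Y -> X) :
  continuous f -> injective f -> hausdorff_space X -> hausdorff_space Y.
Proof.
move=> cf fI hX p q pq; apply: fI; apply: hX => U V Up Vq.
have [z [Uz Vz]] := pq _ _ (cf p U Up) (cf q V Vq).
by exists (f z).
Qed.

(** The setting in which every clopen piece made of one-point components is a
    Cantor set; it covers both [X] and the Cantor space itself. *)
Definition perfect_compactum (R : realType) (X : topologicalType) : Prop :=
  [/\ compact [set: X], hausdorff_space X, pseudometrizable R X
    & perfect_set [set: X]].

Lemma perfect_compactum_cantor (R : realType) : perfect_compactum R cantor_space.
Proof.
split; first exact: cantor_space_compact.
- exact: cantor_space_hausdorff.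
- exact: pseudometrizable_cantor.
- exact: cantor_perfect.
Qed.

Lemma clopen_homeomorphic_cantor (R : realType) (X : topologicalType)
    (S : set X) :
  perfect_compactum R X -> clopen S -> S !=set0 ->
  S `<=` one_point_components X -> homeomorphic S cantor_space.
Proof.
move=> [cX hX mX /perfectTP pX] [oS cS] [s Ss] S1.
have [T ST] := pseudometrizable_set_type (SigSub (mem_set Ss)) mX.
apply: (homeomorphic_trans ST); apply: (@cantor_like_homeomorphic R).
have cST : compact [set: S].
  by apply: compact_set_type; exact: (subclosed_compact cS cX).
have hS : hausdorff_space S.
  by apply: hausdorff_inj hX; [exact: continuous_val|exact: val_inj].
have [f [g [cf cg fK gK]]] := ST; split.
- apply/perfectTP => t ot.
  have /open_set_type[V oV Vt] : open [set g t].
    rewrite (_ : [set g t] = f @^-1` [set t]).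
      by apply: open_comp => // x _; exact: cf.
    by apply/seteqP; split=> [_ ->|x <-] /=.
  apply: (pX (val (g t))).
  rewrite (_ : [set val (g t)] = V `&` S); first exact: openI.
  apply/seteqP; split=> [_ ->|x [Vx Sx]].
    split; last exact: set_valP.
    by have : [set g t] (g t) by []; rewrite Vt.
  have : [set g t] (SigSub (mem_set Sx)) by rewrite Vt.
  by move=> /(congr1 val).
- exact: compact_homeomorphic cST.
- exact: hausdorff_homeomorphic hS.
- move=> t u /eqP tu.
  have gtu : val (g t) <> val (g u) by move=> /val_inj /(can_inj gK).
  have nO : nbhs (val (g t)) (~` [set val (g u)]).
    apply: open_nbhs_nbhs; split=> //; apply: closed_openC.
    exact/accessible_closed_set1/hausdorff_accessible.
  have [D [cD Dt Du]] := clopen_nbhs_one_point cX hX (S1 _ (set_valP (g t))) nO.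
  exists ((val \o g) @^-1` D); split=> //.
    apply: preimage_clopen => // x.
    by apply: continuous_comp; [exact: cg|exact: continuous_val].
  by move=> Dgu; apply: (Du _ Dgu).
Qed.

Lemma countable_nbhs_base (R : realType) (X : topologicalType) (x : X) :
  pseudometrizable R X ->
  exists2 B : nat -> set X, forall n, nbhs x (B n) & sets_converge_to B x.
Proof.
move=> [M [f [g [cf cg fK gK]]]].
exists (fun n => f @^-1` ball (f x) n.+1%:R^-1%R) => [n|U nU].
  by apply: cf; apply: nbhsx_ballx; rewrite invr_gt0 ltr0n.
have /nbhs_ballP[e e0 eU] : nbhs (f x) (g @^-1` U) by apply: cg; rewrite fK.
have [N Ne] := @ltr_add_invr R 0%R e e0.
exists N => // n /= Nn y /= fy; rewrite -(fK y); apply: eU.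
apply: le_ball fy; apply: le_trans (ltW Ne); rewrite add0r.
by rewrite lef_pV2 ?posrE ?ltr0n// ler_nat ltnS.
Qed.

(** * Sequences and partitions into Cantor sets *)

(** Pick Cantor sets in [Q] one after the other, each inside a neighbourhood of
    [x] that avoids the previous ones and lies in the next member of a countable
    neighbourhood base; such neighbourhoods exist as clopen subsets of [Q] miss
    [x]. *)
Lemma cantor_sets_converging (R : realType) (X : topologicalType) (x : X)
    (Q : set X) :
  perfect_compactum R X -> open Q -> Q `<=` one_point_components X ->
  closure Q x -> ~ Q x ->
  exists S : nat -> set X,
    [/\ trivIset setT S, forall n, clopen (S n),
        forall n, homeomorphic (S n) cantor_space, forall n, S n `<=` Q
      & sets_converge_to S x].
Proof.
move=> pcX oQ Q1 Qx nQx; have [cX hX mX pX] := pcX.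
have [B nB Bx] := countable_nbhs_base x mX.
have pick (O : set X) : exists S, nbhs x O ->
    [/\ clopen S, S !=set0, S `<=` Q & S `<=` O].
  have [nO|nO] := pselect (nbhs x O); last by exists set0.
  have [q [Qq /= Oq]] := Qx _ (nbhs_interior nO).
  have [||D [cD Dq DQ]] := @clopen_nbhs_one_point X q (Q `&` O°) cX hX.
  - exact: Q1.
  - apply: open_nbhs_nbhs; split=> //.
    by apply: openI => //; exact: open_interior.
  exists D => _; split=> //; first by exists q.
    by move=> y /DQ[].
  by move=> y /DQ[_ /interior_subset].
have [S SP] := choice pick.
pose fix O n := if n is m.+1 then O m `&` B m `&` ~` S (O m) else setT.
have nO n : nbhs x (O n).
  elim: n => [|n IHn] /=; first exact: filterT.
  have [[oS cS] _ SQ _] := SP _ IHn.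
  apply: filterI; first exact: filterI.
  by apply: open_nbhs_nbhs; split; [exact: closed_openC|move=> /SQ].
have OS m n : (m < n)%N -> O n `<=` B m `&` ~` S (O m).
  elim: n => // n IHn; rewrite ltnS leq_eqVlt => /predU1P[-> y [[]]//|/IHn h].
  by move=> y [[/h]].
exists (S \o O); split => /=.
- apply: ltn_trivIset => n m mn; rewrite -subset0 => y [Sm Sn].
  have [_ _ _ SO] := SP _ (nO n).
  by have [_] := OS _ _ mn y (SO y Sn).
- by move=> n; case: (SP _ (nO n)).
- move=> n; have [cS S0 SQ _] := SP _ (nO n).
  by apply: (@clopen_homeomorphic_cantor R) => // y /SQ/Q1.
- by move=> n; case: (SP _ (nO n)).
- move=> U /Bx [N _ NU]; exists N.+1 => // n /= Nn y Sy.
  have [_ _ _ /(_ y Sy) Oy] := SP _ (nO n).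
  by apply: (NU N) => //=; case: (OS N n Nn y Oy).
Qed.

(** The clopen sets of a compact pseudometrizable space are countably many, so
    [V] is exhausted by an increasing sequence of clopen sets.  As [V] is not
    closed it differs from each of them, so the sequence can be made strictly
    increasing; its successive differences are the pieces. *)
Lemma clopen_partition (R : realType) (X : topologicalType) (V : set X) :
  compact [set: X] -> hausdorff_space X -> pseudometrizable R X ->
  open V -> V `<=` one_point_components X -> ~ closed V ->
  exists P : nat -> set X,
    [/\ trivIset setT P, forall n, clopen (P n), forall n, P n !=set0
      & \bigcup_n P n = V].
Proof.
move=> cX hX mX oV V1 ncV.
have nV v : V v -> exists D, [/\ clopen D, D v & D `<=` V].
  move=> Vv; apply: (clopen_nbhs_one_point cX hX (V1 v Vv)).
  exact: open_nbhs_nbhs.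
have V0 : V !=set0.
  by apply/set0P/eqP => V0; apply: ncV; rewrite V0; exact: closed0.
have [E cE EV] : exists2 E : nat -> set X,
    (forall n, clopen (E n) /\ E n `<=` V) & V `<=` \bigcup_n E n.
  have [v Vv] := V0.
  have [T TT] :=
    pseudometrizable_set_type (SigSub (mem_set (I : [set: X] v))) mX.
  have XT : homeomorphic X T := homeomorphic_trans (homeomorphic_setT X) TT.
  have [f [g [cf cg fK gK]]] := XT.
  pose U := unsquash (clopen_surj (compact_homeomorphic XT cX)).
  have U_surj D : clopen D -> exists n, f @^-1` U n = D.
    move=> cD; have : clopen (g @^-1` D) by apply: preimage_clopen.
    move=> /(@surj _ _ _ _ U)[n _ Un]; exists n; rewrite Un.
    by apply/seteqP; split=> y /=; rewrite fK.
  have U_clopen n : clopen (f @^-1` U n).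
    by apply: preimage_clopen => //; exact: funS.
  exists (fun n => if pselect (f @^-1` U n `<=` V) then f @^-1` U n else set0).
    by move=> n; case: pselect => [UV|nUV] /=; split=> //; exact: clopen0.
  move=> y /nV[D [/U_surj[n Un] Dy DV]]; exists n => //.
  by rewrite Un; case: pselect => [DV'|[]].
(* A clopen part of [V] not covered by [D], to keep the pieces nonempty. *)
have grow (D : set X) : exists G, clopen D -> D `<=` V ->
    [/\ clopen G, G `<=` V & G `\` D !=set0].
  have [[[oD clD] DV]|nD] := pselect (clopen D /\ D `<=` V); last first.
    by exists set0 => ? ?; case: nD.
  have [v [Vv nDv]] : V `\` D !=set0.
    apply: contrapT => VD; apply: ncV; rewrite (_ : V = D)//.
    apply/seteqP; split=> // v Vv; apply: contrapT => nDv.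
    by apply: VD; exists v.
  by have [H [cH Hv HV]] := nV v Vv; exists H => _ _; split=> //; exists v.
have [G GP] := choice grow.
pose fix D n := if n is m.+1 then D m `|` E m `|` G (D m) else set0.
have DP n : clopen (D n) /\ D n `<=` V.
  elim: n => [|n [cD DV]] /=; first by split; [exact: clopen0|].
  have [cG GV _] := GP _ cD DV; have [cEn EnV] := cE n.
  split; first by do 2!apply: clopenU => //.
  by move=> y [[/DV|/EnV]|/GV].
have Dmono m n : (m <= n)%N -> D m `<=` D n.
  elim: n => [|n IHn]; first by rewrite leqn0 => /eqP ->.
  rewrite leq_eqVlt ltnS => /predU1P[->//|/IHn h y /h Dy].
  by left; left.
exists (fun n => D n.+1 `\` D n); split.
- apply: ltn_trivIset => n m mn; rewrite -subset0 => y [[Dm _] [_ nD]].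
  by apply: nD; apply: Dmono Dm.
- move=> n; rewrite setDE; apply: clopenI; first exact: (DP n.+1).1.
  by apply: clopenC => //; exact: (DP n).1.
- move=> n; have [cD DV] := DP n; have [_ _ [y [Gy nDy]]] := GP _ cD DV.
  by exists y; split=> //; right.
- apply/seteqP; split=> [y [n _ [Dy _]]|y Vy]; first exact: (DP n.+1).2.
  have [n _ Eny] := EV y Vy.
  have : D n.+1 y by left; right.
  elim: n.+1 => [//|m IHm] Dy; have [/IHm//|nDy] := pselect (D m y).
  by exists m.
Qed.

(** Match the pieces of the two partitions: all are Cantor sets. *)
Lemma homeo_on_noncompact_cantor (R : realType) (X Y : topologicalType)
    (V : set X) (W : set Y) :
  perfect_compactum R X -> perfect_compactum R Y ->
  open V -> V `<=` one_point_components X -> ~ closed V ->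
  open W -> W `<=` one_point_components Y -> ~ closed W ->
  homeo_on V W.
Proof.
move=> pX pY oV V1 ncV oW W1 ncW.
have [cX hX mX _] := pX; have [cY hY mY _] := pY.
have [P [tP cP P0 PV]] := clopen_partition cX hX mX oV V1 ncV.
have [Q [tQ cQ Q0 QW]] := clopen_partition cY hY mY oW W1 ncW.
rewrite -PV -QW; apply: (homeo_on_glue 0%N) => // n.
- exact: (cP n).1.
- exact: (cQ n).1.
have [x _] := P0 n; have [y _] := Q0 n.
apply: (homeomorphic_homeo_on x y); [exact: (cP n).1|exact: (cQ n).1|].
have PC : homeomorphic (P n) cantor_space.
  apply: (clopen_homeomorphic_cantor pX) => // t Pt; apply: V1; rewrite -PV.
  by exists n.
apply: (homeomorphic_trans PC); apply: homeomorphic_sym.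
apply: (clopen_homeomorphic_cantor pY) => // t Qt; apply: W1; rewrite -QW.
by exists n.
Qed.

Lemma open_setC1 (X : topologicalType) (x : X) :
  hausdorff_space X -> open [set~ x].
Proof.
by move=> hX; exact/closed_openC/accessible_closed_set1/hausdorff_accessible.
Qed.

(** * Cards and decks *)

(** A compact Hausdorff space is the one-point compactification of each of its
    cards.  Continuity at the added point holds since the complement of a
    neighbourhood of its image is compact, hence pulled back to a closed set. *)
Lemma homeomorphic_one_point_extension (X Z : topologicalType) (x : X) (z : Z) :
  compact [set: X] -> hausdorff_space X ->
  compact [set: Z] -> hausdorff_space Z ->
  homeo_on [set~ x] [set~ z] -> homeomorphic X Z.
Proof.
move=> cX hX cZ hZ [f [g [fP gP]]].
pose ext (S T : topologicalType) (s : S) (t : T) (h : S -> T) p :=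
  if pselect (p = s) is left _ then t else h p.
have extx (S T : topologicalType) (s : S) (t : T) h : ext S T s t h s = t.
  by rewrite /ext; case: pselect.
have extN (S T : topologicalType) (s : S) (t : T) h p : p <> s ->
    ext S T s t h p = h p.
  by rewrite /ext; case: pselect.
have ext_cont (S T : topologicalType) (s : S) (t : T) h k :
    hausdorff_space S -> compact [set: T] ->
    inverse_on [set~ s] [set~ t] h k -> inverse_on [set~ t] [set~ s] k h ->
    continuous (ext S T s t h).
  move=> hS cT hP kP p.
  have [->|ps] := pselect (p = s); last first.
    have [_ _ ch] := hP p ps.
    move=> U; rewrite extN// => /ch nU.
    have nps : nbhs p [set~ s].
      by apply: open_nbhs_nbhs; split=> //; exact: open_setC1.
    by apply: filterS (filterI nps nU) => q [qs]; rewrite /= extN.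
  move=> U; rewrite extx => /nbhs_interior; rewrite nbhsE => -[O [oO Ot] OU].
  have cO : compact (~` O).
    by apply: (subclosed_compact _ cT) => //; exact: open_closedC.
  have Ot' : ~` O `<=` [set~ t] by move=> q Oq qt; apply: Oq; rewrite qt.
  have cK := inverse_on_image_compact kP cO Ot'.
  have nK : nbhs s (~` (k @` (~` O))).
    apply: open_nbhs_nbhs; split.
      by apply: closed_openC; exact: compact_closed cK.
    by move=> [q Oq kq]; have [ks _ _] := kP q (Ot' q Oq); exact: ks.
  apply: filterS nK => q nq /=; apply: interior_subset; apply: OU.
  have [->|qs] := pselect (q = s); first by rewrite extx.
  rewrite extN//; apply: contrapT => Ohq; apply: nq.
  by exists (h q) => //; case: (hP q qs).
exists (ext X Z x z f), (ext Z X z x g); split.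
- exact: ext_cont fP gP.
- exact: ext_cont gP fP.
- move=> p; have [->|px] := pselect (p = x); first by rewrite !extx.
  by have [? ? _] := fP p px; rewrite !extN// extN.
- move=> p; have [->|pz] := pselect (p = z); first by rewrite !extx.
  by have [? ? _] := gP p pz; rewrite !extN// extN.
Qed.

Lemma deck_card (X Z : topologicalType) (z : Z) :
  deck Z = deck X -> exists x : X, homeomorphic [set~ x] [set~ z].
Proof.
move=> XZ; have : deck Z (homeo_class [set~ z]) by exists z.
by rewrite XZ => -[x /homeo_class_inj/homeomorphic_sym]; exists x.
Qed.

(** For an inhabited type: there are at least three points. *)
Definition three_points (T : Type) : Prop :=
  forall a b : T, exists c : T, c <> a /\ c <> b.

(** Two points are separated inside a card that misses a third point [c].  Opens
    of the card are traces of opens of [Z], which gives first that points are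
    closed, so that cards are open, and then disjoint neighbourhoods. *)
Lemma hausdorff_cards (Z : topologicalType) :
  three_points Z -> (forall z : Z, hausdorff_space [set~ z]) ->
  hausdorff_space Z.
Proof.
move=> Z3 hZ.
have sep (a b c : Z) : a <> b -> a <> c -> b <> c ->
    exists V W : set Z, [/\ open V, open W, V a, W b & V `&` W `<=` [set c]].
  move=> ab ac bc; have := hZ c; rewrite open_hausdorff.
  move=> /(_ (SigSub (mem_set (ac : [set~ c] a)))
             (SigSub (mem_set (bc : [set~ c] b)))) [].
    by apply/eqP => /(congr1 val).
  move=> [A B] /= [/set_mem + /set_mem +] [[V oV VA] [W oW WB] /eqP AB0].
  rewrite -{}VA -{}WB in AB0 * => /= Va Wb; exists V, W; split=> // t [Vt Wt].
  apply: contrapT => tc.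
  have : set0 (SigSub (mem_set (tc : [set~ c] t))).
    by rewrite -AB0; split.
  by [].
have Z1 : accessible_space Z.
  move=> a b /eqP ab; have [c [ca cb]] := Z3 a b.
  have [||V [W [oV oW Va Wb VW]]] := sep a b c ab; try exact: nesym.
  exists V; split=> //; first exact: mem_set.
  by apply/mem_set => Vb; apply: cb; rewrite (VW b (conj Vb Wb)).
rewrite open_hausdorff => a b /eqP ab; have [c [ca cb]] := Z3 a b.
have [||V [W [oV oW Va Wb VW]]] := sep a b c ab; try exact: nesym.
have oc : open [set~ c] by apply: closed_openC; exact: accessible_closed_set1.
exists (V `&` [set~ c], W `&` [set~ c]).
  by split; apply/mem_set; split=> //; exact: nesym.
split; [exact: openI|exact: openI|apply/eqP].
by rewrite -subset0 => t [[Vt tc] [Wt _]]; apply: tc; exact: VW.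
Qed.

Lemma three_points_deck (X Z : topologicalType) (x : X) :
  three_points X -> deck Z = deck X -> three_points Z.
Proof.
move=> X3 XZ a b.
have [z /homeomorphic_sym[f [_ [_ _ /can_inj fI _]]]] :=
  deck_card x (esym XZ).
have [p [px _]] := X3 x x; have [q [qx qp]] := X3 x p.
pose u : [set~ x] := SigSub (mem_set (px : [set~ x] p)).
pose v : [set~ x] := SigSub (mem_set (qx : [set~ x] q)).
have uz : val (f u) <> z := set_valP (f u).
have vz : val (f v) <> z := set_valP (f v).
have uv : val (f u) <> val (f v).
  by move=> /val_inj/fI/(congr1 val) /= /esym.
apply: contrapT => nc.
have ab c : c = a \/ c = b.
  by apply: contrapT => /not_orP[ca cb]; apply: nc; exists c.
move: (val (f u)) (val (f v)) uz vz uv => s t.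
by case: (ab z) (ab s) (ab t) => -> [] -> [] ->.
Qed.

Lemma hausdorff_deck (X Z : topologicalType) (x : X) :
  three_points X -> hausdorff_space X -> deck Z = deck X -> hausdorff_space Z.
Proof.
move=> X3 hX XZ; apply: hausdorff_cards; first exact: three_points_deck XZ.
move=> z; have [y yz] := deck_card z XZ; apply: hausdorff_homeomorphic yz _.
by apply: hausdorff_inj hX; [exact: continuous_val|exact: val_inj].
Qed.

Lemma reconstructible_one_point (X : topologicalType) (x : X) :
  (forall y : X, y = x) -> reconstructible X.
Proof.
move=> X1 Z XZ; have [z [f _]] := deck_card x (esym XZ).
have Z1 t : t = z.
  apply: contrapT => tz.
  pose t' : [set~ z] := SigSub (mem_set (tz : [set~ z] t)).
  by have := set_valP (f t'); apply; exact: X1.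
exists (fun=> x), (fun=> z); split.
- exact: cst_continuous.
- exact: cst_continuous.
- by move=> t; rewrite (Z1 t).
- by move=> y; rewrite (X1 y).
Qed.

(** * One-point components and isolated points *)
Lemma one_point_component_clopen (X : topologicalType) (q : X) :
  (forall p, p <> q -> exists D : set X, [/\ clopen D, D q & ~ D p]) ->
  one_point_components X q.
Proof.
move=> sep; apply/seteqP; split=> [p|_ ->]; last first.
  exact: connected_component_refl.
move=> [C [Cq _ cC] Cp]; apply: contrapT => /sep[D [[oD cD] Dq nDp]].
apply: nDp; have : C `&` D = C.
  by apply: cC; [exists q|exists D|exists D].
by move=> CD; have [] : (C `&` D) p by rewrite CD.
Qed.

Lemma clopen_image_val (X : topologicalType) (S : set X) (U : set S) :
  clopen S -> clopen U -> clopen (val @` U).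
Proof.
move=> [oS cS] [/open_set_type[V oV UV] /closed_openC/open_set_type[W oW UW]].
split.
  rewrite (_ : _ @` U = V `&` S); first exact: openI.
  rewrite UV; apply/seteqP; split=> [_ [s Vs <-]|x [Vx Sx]].
    by split=> //; exact: set_valP.
  by exists (SigSub (mem_set Sx)).
rewrite (_ : _ @` U = S `&` ~` W).
  by apply: closedI => //; exact: open_closedC.
have UWE : U = ~` (val @^-1` W) by rewrite -UW setCK.
rewrite UWE; apply/seteqP; split=> [_ [s Vs <-]|x [Sx Wx]].
  by split=> //; exact: set_valP.
by exists (SigSub (mem_set Sx)).
Qed.

Lemma clopen_cantor_one_point (X : topologicalType) (S : set X) :
  clopen S -> homeomorphic S cantor_space -> S `<=` one_point_components X.
Proof.
move=> cS [f [g [cf cg fK gK]]] q Sq; apply: one_point_component_clopen => p pq.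
have [Sp|Sp] := pselect (S p); last by exists S.
pose q' : S := SigSub (mem_set Sq); pose p' : S := SigSub (mem_set Sp).
have fqp : f q' != f p'.
  by apply/eqP => /(can_inj fK)/(congr1 val) /= qp; apply: pq.
have [D [cD Dq Dp]] := cantor_zero_dimensional fqp.
exists (val @` (f @^-1` D)); split.
- by apply: clopen_image_val => //; exact: preimage_clopen.
- by exists q'.
- by move=> [t Dt tp]; apply: Dp; rewrite (_ : p' = t)//; exact: val_inj.
Qed.

Lemma isolated_open (X : topologicalType) (U : set X) (x : X) :
  open U -> isolated U x -> open [set x].
Proof.
move=> oU [/set_mem Ux [V nV VU]]; rewrite openE => _ ->.
by rewrite /interior -VU; apply: filterI => //; exact: open_nbhs_nbhs.
Qed.

Lemma open1_isolated (X : topologicalType) (U : set X) (x : X) :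
  dense U -> open [set x] -> isolated U x.
Proof.
move=> dU ox; have [_ [-> Ux]] := dU [set x] (ex_intro _ x erefl) ox.
split; first exact: mem_set.
exists [set x]; first exact: open_nbhs_nbhs.
by apply/seteqP; split=> [y []|_ ->].
Qed.

Lemma perfect_dense_setC1 (X : topologicalType) (x : X) :
  perfect_set [set: X] -> dense [set~ x].
Proof.
move=> /perfectTP_ex pX O O0 oO; have [s [t [Os Ot st]]] := pX O oO O0.
have [sx|sx] := pselect (s = x); last by exists s.
by exists t; split=> // tx; move/eqP: st; apply; rewrite sx tx.
Qed.

Lemma dense_closure (X : topologicalType) (S : set X) (x : X) :
  dense S -> closure S x.
Proof.
move=> dS B /nbhs_interior nB.
have [|y [By Sy]] := dS B° _ (@open_interior _ _).
  by exists x; exact: nbhs_singleton.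
by exists y; split=> //; exact: interior_subset.
Qed.

Lemma homeomorphic_cantor_nonempty (X : topologicalType) (S : set X) :
  homeomorphic S cantor_space -> S !=set0.
Proof.
by move=> [_ [g _]]; exists (val (g (point : cantor_space))); exact: set_valP.
Qed.

(** * Density, universal sequences and compactifications *)

(** The members of a universal sequence lie in the interior, as their points are
    one-point components and they are open.  An isolated point would contain two
    of the disjoint nonempty members of its sequence. *)
Lemma constant_universal_sequence_dense (X : topologicalType) :
  constant_universal_sequence cantor_space X ->
  isolated (one_point_components X)° = set0 /\ dense (one_point_components X)°.
Proof.
move=> univ; split.
  rewrite -subset0 => x /(isolated_open (@open_interior _ _)) ox.
  have [B [tB cB BC Bx]] := univ x.
  have [N _ BN] := Bx [set x] (open_nbhs_nbhs (conj ox erefl)).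
  have [y By] := homeomorphic_cantor_nonempty (BC N).
  have [z Bz] := homeomorphic_cantor_nonempty (BC N.+1).
  have yx : y = x := BN N (leqnn N) y By.
  have zx : z = x := BN N.+1 (leqnSn N) z Bz.
  rewrite yx zx in By Bz.
  have := tB N N.+1 I I (ex_intro _ x (conj By Bz)) => /eqP.
  by rewrite -[X in X == _]addn0 -addn1 eqn_add2l.
move=> O [x Ox] oO; have [B [_ cB BC Bx]] := univ x.
have [N _ /(_ N (leqnn N)) BO] := Bx O (open_nbhs_nbhs (conj oO Ox)).
have [y By] := homeomorphic_cantor_nonempty (BC N).
exists y; split; first exact: BO.
rewrite /interior; apply: (@filterS _ _ _ (B N)).
  exact: clopen_cantor_one_point.
by apply: open_nbhs_nbhs; split=> //; exact: (cB N).1.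
Qed.

Lemma dense_perfect (X : topologicalType) (U : set X) :
  isolated U = set0 -> dense U -> perfect_set [set: X].
Proof.
move=> iU dU; apply/perfectTP => x /(open1_isolated dU).
by rewrite iU.
Qed.

Lemma dense_compactification (R : realType) (X : topologicalType)
    (c0 : cantor_space) :
  perfect_compactum R X -> dense (one_point_components X)° ->
  (one_point_components X)° !=set0 -> compactification_of X [set~ c0].
Proof.
move=> pcX dU [p Up]; have [cX hX _ pX] := pcX; split=> //.
have pcC := perfect_compactum_cantor R.
exists ((one_point_components X)° `&` [set~ p]).
have dUp : dense ((one_point_components X)° `&` [set~ p]).
  by apply: denseI => //; [exact: open_interior|exact: perfect_dense_setC1].
split=> //; apply: homeo_on_homeomorphic.
apply: (homeo_on_noncompact_cantor pcX pcC).
- by apply: openI; [exact: open_interior|exact: open_setC1].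
- by move=> y [/interior_subset].
- by move=> /(_ p (@dense_closure _ _ p dUp))[_]; apply.
- by apply: open_setC1; exact: cantor_space_hausdorff.
- move=> y _.
  exact: zero_dimension_totally_disconnected cantor_zero_dimensional y I.
- have dc := perfect_dense_setC1 c0 cantor_perfect.
  by move=> /(_ c0 (@dense_closure _ _ c0 dc)); apply.
Qed.

(** A clopen set [K] of the Cantor space that avoids [c0] has a compact, hence
    closed, image in [X]; the image is also open, because the trace on the dense
    subspace of an open set [G] is dense in [G].  So these images are clopen in
    [X], and they separate the points of the subspace from all others. *)
Lemma compactification_dense (X : topologicalType) (c0 : cantor_space) :
  compactification_of X [set~ c0] ->
  isolated (one_point_components X)° = set0 /\ dense (one_point_components X)°.
Proof.
move=> [cX hX [D [dD DC]]].
have hC := cantor_space_hausdorff; have oC : open [set~ c0] := open_setC1 c0 hC.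
have [x0 _] : exists x : X, True.
  have [c cc0] : [set~ c0] !=set0.
    have [t [u [_ _ /eqP tu]]] :=
      (perfectTP_ex.1 cantor_perfect) setT openT (ex_intro _ c0 I).
    have [tc|tc] := pselect (t = c0); last by exists t.
    by exists u => uc; apply: tu; rewrite tc uc.
  by have [_ [g _]] := DC; exists (val (g (SigSub (mem_set cc0)))).
have [r [e [cr ce rK eK]]] := DC.
have eP := homeomorphic_inverse_on c0 x0 oC ce eK.
set e' := (fun c => _) in eP; set r' := (fun d => _) in eP.
have eE (c : [set~ c0]) : e' (val c) = val (e c) by rewrite /e' valK.
have rE (d : D) : r' (val d) = val (r d) by rewrite /r' valK.
have r'P d : D d -> [set~ c0] (r' d) /\ e' (r' d) = d.
  move=> Dd; pose d' : D := SigSub (mem_set Dd).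
  rewrite (_ : r' d = val (r d')); last by rewrite -rE.
  by split; [exact: set_valP|rewrite eE rK].
have clopen_e K : clopen K -> ~ K c0 -> clopen (e' @` K).
  move=> [oK cK] Kc0.
  have KC : K `<=` [set~ c0] by move=> c Kc cc0; apply: Kc0; rewrite -cc0.
  have clE : closed (e' @` K).
    apply: (compact_closed hX); apply: (inverse_on_image_compact eP) => //.
    exact: (subclosed_compact cK cantor_space_compact).
  split=> //.
  have /open_set_type[G oG KG] : open (r @^-1` (val @^-1` K)).
    apply: open_comp => [d _|]; first exact: cr.
    by apply: open_comp => // c _; exact: continuous_val.
  rewrite (_ : e' @` K = G)//; apply/seteqP; split=> [_ [c Kc <-]|t Gt].
    pose c' : [set~ c0] := SigSub (mem_set (KC c Kc)).
    have : (r @^-1` (val @^-1` K)) (e c') by rewrite /= eK.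
    by rewrite KG /= -eE.
  apply: clE => B /nbhs_interior nB.
  have [|d [[Gd Bd] Dd]] := dD (G `&` B°) _ (openI oG (@open_interior _ _)).
    by exists t; split=> //; exact: nbhs_singleton.
  exists d; split; last exact: interior_subset.
  exists (r' d); last exact: (r'P d Dd).2.
  pose d' : D := SigSub (mem_set Dd).
  have : (val @^-1` G) d' by [].
  by rewrite -KG /= -rE.
have sepc c d : c <> d ->
    exists K : set cantor_space, [/\ clopen K, K c & ~ K d].
  by move=> /eqP; exact: cantor_zero_dimensional.
have D1 : D `<=` one_point_components X.
  move=> d Dd; have [rc0 erd] := r'P d Dd.
  have [K [cK Kd Kc0]] := sepc _ _ rc0.
  apply: one_point_component_clopen => p pd.
  have [Dp|nDp] := pselect (D p); last first.
    exists (e' @` K); split; [exact: clopen_e|by exists (r' d)|].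
    move=> [c Kc cp]; apply: nDp; rewrite -cp.
    have cc0 : [set~ c0] c by move=> cc0; apply: Kc0; rewrite -cc0.
    by case: (eP c cc0).
  have [rpc0 erp] := r'P p Dp.
  have rdp : r' d <> r' p by move=> rdp; apply: pd; rewrite -erd -erp rdp.
  have [H [cH Hd Hp]] := sepc _ _ rdp.
  exists (e' @` (K `&` H)); split.
  - by apply: clopen_e; [exact: clopenI|case].
  - by exists (r' d).
  - move=> [c [Kc Hc] cp]; apply: Hp.
    have cc0 : [set~ c0] c by move=> cc0; apply: Kc0; rewrite -cc0.
    by have [_ rec _] := eP c cc0; rewrite -cp rec.
have DU : D `<=` (one_point_components X)°.
  move=> d Dd; have [rc0 erd] := r'P d Dd.
  have [K [cK Kd Kc0]] := sepc _ _ rc0.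
  apply: (@filterS _ _ _ (e' @` K)); last first.
    by apply: open_nbhs_nbhs; split; [case: (clopen_e K cK Kc0)|exists (r' d)].
  move=> _ [c Kc <-]; apply: D1.
  have cc0 : [set~ c0] c by move=> cc0; apply: Kc0; rewrite -cc0.
  by case: (eP c cc0).
split; last first.
  by move=> O O0 oO; have [d [Od /DU Ud]] := dD O O0 oO; exists d.
rewrite -subset0 => q /(isolated_open (@open_interior _ _)) oq.
have [_ [-> Dq]] := dD _ (ex_intro _ q erefl) oq.
have [rc0 erq] := r'P q Dq; have [_ _ ce'] := eP _ rc0.
move/perfectTP: cantor_perfect => /(_ (r' q)); apply.
rewrite openE => _ ->; rewrite /interior.
have n1 : nbhs (r' q) [set~ c0] by exact: open_nbhs_nbhs.
have n2 : nbhs (r' q) (e' @^-1` [set q]).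
  by apply: ce'; rewrite erq; exact: open_nbhs_nbhs.
apply: filterS (filterI n1 n2) => c [cc0 ecq].
by have [_ rec _] := eP c cc0; rewrite -rec /= ecq.
Qed.

(** * Removing one more point from a card *)
Lemma closed_bigcup_converging (X : topologicalType) (S : nat -> set X)
    (y : X) :
  hausdorff_space X -> (forall n, closed (S n)) -> sets_converge_to S y ->
  closed (\bigcup_n S n `|` [set y]).
Proof.
move=> hX cS Sy; rewrite -openC openE => p /not_orP[Sp py].
have /eqP py' : p <> y := py.
move: hX; rewrite open_hausdorff => /(_ p y py')[[G O]] /=.
move=> [/set_mem Gp /set_mem Oy] [oG oO /eqP GO].
have [N _ NO] := Sy O (open_nbhs_nbhs (conj oO Oy)).
have : \forall z \near p, forall n, (n < N)%N -> ~ S n z.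
  elim: (N) => [|m IHm]; first by apply: nearW => z n.
  have nSm : nbhs p (~` S m).
    apply: open_nbhs_nbhs; split; first exact: closed_openC.
    by move=> Smp; apply: Sp; exists m.
  apply: filterS (filterI IHm nSm) => z [zlt zm] n.
  by rewrite ltnS leq_eqVlt => /predU1P[->|/zlt].
rewrite /interior => H; have nG : nbhs p G by exact: open_nbhs_nbhs.
apply: filterS (filterI H nG) => z [Hz Gz] [[n _ Snz]|zy].
  have [/Hz|/NO/(_ z Snz) Oz] := ltnP n N; first exact.
  by suff : set0 z by []; rewrite -GO.
by suff : set0 z by []; rewrite -GO; split=> //; rewrite zy.
Qed.

(** The Cantor sets converging to [y], enlarged by a clopen neighbourhood of
    [x], form an open set [A] that is not closed, and neither is [A] minus [x],
    so the two are homeomorphic.  Adding [y] to [A] gives a closed set, so the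
    rest of the card is open and can be mapped identically. *)
Lemma homeo_on_card_remove (R : realType) (X : topologicalType) (x y : X) :
  perfect_compactum R X -> dense (one_point_components X)° ->
  (one_point_components X)° x -> x <> y ->
  homeo_on [set~ y] ([set~ y] `&` [set~ x]).
Proof.
move=> pcX dU Ux xy; have [cX hX _ pX] := pcX.
set U := (one_point_components X)° in dU Ux.
have oU : open U := @open_interior _ _.
have U1 : U `<=` one_point_components X := @interior_subset _ _.
have nx : nbhs x (U `&` [set~ y]).
  by apply: open_nbhs_nbhs; split=> //; apply: openI => //; exact: open_setC1.
have [W [[oW clW] Wx WU]] := clopen_nbhs_one_point cX hX (U1 x Ux) nx.
have dUy : dense (U `&` [set~ y]).
  by apply: denseI => //; exact: perfect_dense_setC1.
have [|||S [_ cS SC SU Sy]] :=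
  cantor_sets_converging pcX _ _ (@dense_closure _ _ y dUy).
- by apply: openI => //; exact: open_setC1.
- by move=> z [/U1].
- by move=> [_]; apply.
pose A := W `|` \bigcup_n S n.
have oA : open A.
  by apply: openU => //; apply: bigcup_open => n _; exact: (cS n).1.
have AU : A `<=` U `&` [set~ y] by move=> z [/WU//|[n _ /SU]].
have A1 : A `<=` one_point_components X by move=> z /AU[/U1].
have Ay : closure A y.
  move=> B /Sy[N _ /(_ N (leqnn N)) NB].
  have [z Sz] := homeomorphic_cantor_nonempty (SC N).
  by exists z; split; [right; exists N|exact: NB].
have oB : open (~` (A `|` [set y])).
  apply: closed_openC; rewrite -setUA; apply: closedU => //.
  by apply: closed_bigcup_converging => // n; exact: (cS n).2.
have Ax : closure (A `&` [set~ x]) y.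
  move=> B nB; have nBx : nbhs y (B `&` [set~ x]).
    apply: filterI => //; apply: open_nbhs_nbhs; split; first exact: open_setC1.
    exact: nesym.
  by have [z [Az [Bz zx]]] := Ay _ nBx; exists z.
have AAx : homeo_on A (A `&` [set~ x]).
  apply: (homeo_on_noncompact_cantor pcX pcX) => //.
  - by move=> /(_ y Ay)/AU[_]; apply.
  - by apply: openI => //; exact: open_setC1.
  - by move=> z [/A1].
  - by move=> /(_ y Ax)[/AU[_ +] _]; apply.
pose P (V : set X) b := if b then V else ~` (A `|` [set y]).
have PE V : V `<=` A -> trivIset setT (P V).
  move=> VA; apply/trivIsetP => -[] [] //= _ _ _; rewrite -subset0.
    by move=> z [/VA Az]; apply; left.
  by move=> z [+ /VA Az]; apply; left.
have AxA : A `&` [set~ x] `<=` A := @subIsetl _ _ _.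
have -> : [set~ y] = \bigcup_b P A b.
  apply/seteqP; split=> [z zy|z [[] _ /=]].
  - by have [Az|nAz] := pselect (A z); [exists true|exists false => // -[]].
  - by move=> /AU[].
  - by move=> nz zy; apply: nz; right.
have -> : (\bigcup_b P A b) `&` [set~ x] = \bigcup_b P (A `&` [set~ x]) b.
  apply/seteqP; split=> [z [[[] _ /= Pz] zx]|z [[] _ /=]].
  - by exists true.
  - by exists false.
  - by move=> [Az zx]; split=> //; exists true.
  - move=> nz; split; first by exists false.
    by move=> zx; apply: nz; left; left; rewrite zx.
apply: (homeo_on_glue true);
  [exact: PE|exact: PE|case=> //|case=> //|case=> //].
  by apply: openI => //; exact: open_setC1.
exact: homeo_on_refl.
Qed.

Lemma dense_not_reconstructible (R : realType) (X : topologicalType) :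
  perfect_compactum R X -> dense (one_point_components X)° ->
  (one_point_components X)° !=set0 -> ~ reconstructible X.
Proof.
move=> pcX dU [x0 Ux0] recX; have [cX hX mX pX] := pcX.
pose Z : topologicalType := [set~ x0].
have cardZ (z : Z) : homeomorphic [set~ z] [set~ val z].
  apply: homeomorphic_trans (homeomorphic_set_type_in _) _.
  apply/homeomorphic_sym/homeo_on_homeomorphic.
  have -> : val @` [set~ z] = [set~ val z] `&` [set~ x0].
    apply/seteqP; split=> [_ [t tz <-]|y [yz yx]].
      by split; [move=> /val_inj|exact: set_valP].
    exists (SigSub (mem_set yx)) => //= zy; apply: yz.
    by rewrite -zy.
  apply: (homeo_on_card_remove pcX dU Ux0) => xz.
  by apply: (set_valP z); rewrite -xz.
have deckZ : deck Z = deck X.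
  apply/funext => K; apply/propext; split=> [[z ->]|[y ->]].
    by exists (val z); exact: homeomorphic_homeo_class.
  have [yx|yx] := pselect (y = x0); last first.
    exists (SigSub (mem_set (yx : [set~ x0] y))).
    exact/homeomorphic_homeo_class/homeomorphic_sym/cardZ.
  have [w [Uw wx]] : (one_point_components X)° `&` [set~ x0] !=set0.
    have := @perfect_dense_setC1 X x0 pX (one_point_components X)°.
    by apply; [exists x0|exact: open_interior].
  exists (SigSub (mem_set wx)); rewrite {}yx.
  apply: homeomorphic_homeo_class; apply: homeomorphic_sym.
  apply: homeomorphic_trans (cardZ _) _ => /=; apply: homeo_on_homeomorphic.
  have h1 := homeo_on_card_remove pcX dU Ux0 (nesym wx).
  have h2 := homeo_on_card_remove pcX dU Uw wx.
  by apply: homeo_on_trans h1 _; rewrite setIC; exact: homeo_on_sym.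
have [f [g [cf cg fK gK]]] := recX Z deckZ.
have cZ : compact [set: Z] by apply: compact_homeomorphic cX; exists g, f.
have cx0 : closed [set~ x0].
  apply: (compact_closed hX).
  rewrite (_ : [set~ x0] = (val : Z -> X) @` setT).
    apply: continuous_compact cZ; apply: continuous_subspaceT.
    exact: continuous_val.
  apply/seteqP; split=> [y yx|_ [z _ <-]]; last exact: set_valP.
  by exists (SigSub (mem_set yx)).
by apply: (perfectTP.1 pX x0); rewrite -closedC.
Qed.

(** * Noncompact spaces with the same deck *)

(** [z] survives in the card missing [z2], which is an open subset of a compact
    space, hence locally compact. *)
Lemma compact_nbhs_card (X Z : topologicalType) (x : X) (z2 z : Z) :
  compact [set: X] -> hausdorff_space X -> hausdorff_space Z ->
  homeo_on [set~ x] [set~ z2] -> z <> z2 -> exists2 N, compact N & nbhs z N.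
Proof.
move=> cX hX hZ [f [g [fP gP]]] zz2.
have [gzx fgz _] := gP z zz2.
have nx : nbhs (g z) [set~ x].
  by apply: open_nbhs_nbhs; split=> //; exact: open_setC1.
have [B nB Bx] := @compact_regular X (g z) setT hX cX filterT _ nx.
exists (f @` closure B).
  apply: (inverse_on_image_compact fP) => //.
  by apply: (subclosed_compact _ cX) => //; exact: closed_closure.
have BB : B° `<=` closure B.
  by apply: subset_trans (@subset_closure _ B); exact: interior_subset.
apply: (@filterS _ _ _ (f @` B°)); first exact: image_subset.
apply: open_nbhs_nbhs; split; last first.
  by exists (g z) => //; exact: nbhs_singleton (nbhs_interior nB).
apply: (inverse_on_image_open fP gP) => //.
- exact: open_setC1.
- exact: open_interior.
- by apply: subset_trans Bx.
Qed.

(** The complement of an open neighbourhood of [y] is compact, so it meets only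
    finitely many members of a family that is locally finite away from [y]. *)
Lemma compact_locally_finite_converging (X : topologicalType) (y : X)
    (S : nat -> set X) :
  compact [set: X] -> 
  (forall p, p <> y -> exists2 G, nbhs p G &
     exists N, forall n, (N <= n)%N -> S n `&` G = set0) ->
  sets_converge_to S y.
Proof.
move=> cX lf V /nbhs_interior nV.
have /compact_near_coveringP cK : compact (~` V°).
  apply: (subclosed_compact _ cX) => //.
  by apply: open_closedC; exact: open_interior.
have H : \forall n \near \oo, ~` V° `<=` (fun p => ~ S n p).
  apply: cK => p Vp.
  have [py|py] := pselect (p = y).
    by case: Vp; rewrite py; exact: nbhs_singleton.
  have [G nG [N NG]] := lf p py.
  exists (G, [set n | (N <= n)%N]) => /=.
    by split=> //; exists N.
  move=> [t n] [/= Gt Nn] St; suff : set0 t by [].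
  by rewrite -(NG n Nn).
apply: filterS H => n H t St; apply: interior_subset; apply: contrapT => Vt.
exact: H Vt St.
Qed.

Lemma not_reconstructible_constant_universal_sequence (R : realType)
    (X : topologicalType) :
  compact [set: X] -> hausdorff_space X -> pseudometrizable R X ->
  (one_point_components X)° !=set0 -> three_points X ->
  ~ reconstructible X -> constant_universal_sequence cantor_space X.
Proof.
move=> cX hX mX [x Ux] X3 /existsNP[Z /not_implyP[deckZ ZX]].
have hZ : hausdorff_space Z := hausdorff_deck x X3 hX deckZ.
have Z3 : three_points Z := three_points_deck x X3 deckZ.
have [z /homeomorphic_sym xz'] := deck_card x (esym deckZ).
have card (t : X) (u : Z) : homeomorphic [set~ t] [set~ u] ->
    homeo_on [set~ t] [set~ u].
  by apply: (homeomorphic_homeo_on t u); exact: open_setC1.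
have ncZ : ~ compact [set: Z].
  move=> cZ; apply: ZX; apply: homeomorphic_sym.
  exact: homeomorphic_one_point_extension (card _ _ xz').
have pX : perfect_set [set: X].
  apply/perfectTP => t ot; apply: ncZ.
  have [u /homeomorphic_sym/card[f [g [fP gP]]]] := deck_card t (esym deckZ).
  have ct : compact [set~ t].
    by apply: (subclosed_compact _ cX) => //; exact: open_closedC.
  have cft := inverse_on_image_compact fP ct (@subset_refl _ _).
  have := compactU cft (@compact_set1 _ u).
  congr compact; apply/seteqP; split=> // v _.
  have [->|vu] := pselect (v = u); first by right.
  by left; have [gvt fgv _] := gP v vu; exists (g v).
have pcX : perfect_compactum R X by split.
have [f [g [fP gP]]] := card _ _ xz'.
set U := (one_point_components X)° in Ux.
have oU : open U := @open_interior _ _.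
have U1 : U `<=` one_point_components X := @interior_subset _ _.
have [N cN nN] : exists2 N, compact N & nbhs z N.
  have [u [uz _]] := Z3 z z; have [t tu] := deck_card u deckZ.
  exact: compact_nbhs_card (card _ _ tu) (nesym uz).
have clN : closed N := compact_closed hZ cN.
(* The part of the card that [f] sends to infinity in [Z]; it accumulates at
   [x], for otherwise [Z] would be the union of [N] and a compact set. *)
pose Q := (U `&` [set~ x]) `&` f @^-1` (~` N).
have oQ : open Q.
  rewrite openE => t [[Ut tx] fN]; have [_ _ cf] := fP t tx.
  apply: filterI.
    by apply: open_nbhs_nbhs; split=> //; apply: openI => //; exact: open_setC1.
  by apply: cf; apply: open_nbhs_nbhs; split=> //; exact: closed_openC.
have Qx : closure Q x.
  apply: contrapT => /existsNP[O /not_implyP[nO QO]].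
  apply: ncZ; pose K := ~` (O `&` U)°.
  have cK : compact K.
    apply: (subclosed_compact _ cX) => //.
    by apply: open_closedC; exact: open_interior.
  have nx : nbhs x (O `&` U)°.
    by apply/nbhs_interior/filterI => //; exact: open_nbhs_nbhs.
  have Kx : K `<=` [set~ x].
    by move=> t Kt tx; apply: Kt; rewrite tx; exact: nbhs_singleton.
  have := compactU cN (inverse_on_image_compact fP cK Kx).
  congr compact; apply/seteqP; split=> // v _.
  have [Nv|Nv] := pselect (N v); [by left|right].
  have vz : v <> z by move=> vz; apply: Nv; rewrite vz; exact: nbhs_singleton.
  have [gvx fgv _] := gP v vz; exists (g v) => //.
  move=> /interior_subset[Ogv Ugv]; apply: QO; exists (g v); split=> //.
  by split=> //=; rewrite fgv.
have [||S [tS cS SC SQ Sx]] := cantor_sets_converging pcX oQ _ Qx.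
- by move=> t [[/U1]].
- by move=> [[_ +] _]; apply.
have Snx n : S n `<=` [set~ x] by move=> t /SQ[[]].
pose T n := f @` S n.
(* At [z] the neighbourhood [N] works; elsewhere [S] accumulates only at [x]. *)
have T_finite (p : Z) : exists2 G, nbhs p G &
    exists N, forall n, (N <= n)%N -> T n `&` G = set0.
  have [->|pz] := pselect (p = z).
    exists N => //; exists 0%N => n _; rewrite -subset0 => _ [[t St <-] Nft].
    by have [_ /(_ Nft)] := SQ n t St.
  have [gpx fgp cg] := gP p pz.
  have /eqP gpx' : g p <> x := gpx.
  move: hX; rewrite open_hausdorff => /(_ _ _ gpx')[[G O]] /=.
  move=> [/set_mem Gp /set_mem Ox] [oG oO /eqP GO].
  have [m _ mO] := Sx O (open_nbhs_nbhs (conj oO Ox)).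
  exists (g @^-1` G); first by apply: cg; exact: open_nbhs_nbhs.
  exists m => n mn; rewrite -subset0 => _ [[t St <-] /= Gt].
  have [_ gft _] := fP t (Snx n t St).
  suff : set0 t by [].
  by rewrite -GO; split; [rewrite -gft|exact: (mO n)].
have oT n : open (T n).
  apply: (inverse_on_image_open fP gP) (Snx n); first exact: open_setC1.
  exact: (cS n).1.
have cT n : compact (T n).
  apply: (inverse_on_image_compact fP) (Snx n).
  exact: (subclosed_compact (cS n).2 cX).
have tT : trivIset setT T.
  move=> i j _ _ [_ [[s Si <-] [t Sj fts]]].
  apply: tS => //; exists s; split=> //.
  have [_ gfs _] := fP s (Snx i s Si); have [_ gft _] := fP t (Snx j t Sj).
  by rewrite -gfs -fts gft.
have TC n : homeo_on (T n) [set: cantor_space].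
  have [s _] := homeomorphic_cantor_nonempty (SC n).
  apply: homeo_on_trans (homeo_on_sym (inverse_on_sub fP gP (Snx n))) _.
  by apply/(homeo_on_setT s point (cS n).1).
move=> y.
have [u /homeomorphic_sym/card[h [k [hP kP]]]] := deck_card y (esym deckZ).
(* Only finitely many members of [T] can contain the deleted point [u]; the
   first [m] ones are dropped. *)
have [G nG [m mG]] := T_finite u.
have Tu n : T (n + m)%N `<=` [set~ u].
  move=> t Tt tu; suff : set0 t by [].
  rewrite -(mG (n + m)%N (leq_addl _ _)); split=> //.
  by rewrite tu; exact: nbhs_singleton.
have okT n : open (k @` T (n + m)%N).
  by apply: (inverse_on_image_open kP hP) (Tu n); [exact: open_setC1|].
exists (fun n => k @` T (n + m)%N); split.
- move=> i j _ _ [_ [[s Ti <-] [t Tj kts]]].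
  apply: (@addIn m); apply: tT => //; exists s; split=> //.
  have [_ hks _] := kP s (Tu i s Ti); have [_ hkt _] := kP t (Tu j t Tj).
  by rewrite -hks -kts hkt.
- move=> n; split; first exact: okT.
  apply: (compact_closed hX); apply: (inverse_on_image_compact kP) (Tu n).
  exact: cT.
- move=> n; apply/(homeo_on_setT y point (okT n)).
  exact: homeo_on_trans (homeo_on_sym (inverse_on_sub kP hP (Tu n))) (TC _).
- apply: (compact_locally_finite_converging cX) => p py.
  have [hpu khp ch] := hP p py.
  have [B nB [j jB]] := T_finite (h p).
  exists (h @^-1` B); first exact: ch.
  exists j => n jn; rewrite -subset0 => _ [[t Tt <-] /= Bhkt].
  have [_ hkt _] := kP t (Tu n t Tt).
  suff : set0 t by [].
  rewrite -(jB (n + m)%N (leq_trans jn (leq_addr _ _))); split=> //.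
  by rewrite -hkt.
Qed.

Lemma not_reconstructible_three_points (X : topologicalType) (x : X) :
  ~ (exists a b : X, a <> b /\ [set: X] = [set a; b]) -> ~ reconstructible X ->
  three_points X.
Proof.
move=> X2 recX a b; apply: contrapT => nc.
have ab c : c = a \/ c = b.
  by apply: contrapT => /not_orP[ca cb]; apply: nc; exists c.
have [eab|nab] := pselect (a = b).
  by apply: recX; apply: (reconstructible_one_point (x := a)) => y;
    case: (ab y) => ->.
apply: X2; exists a, b; split=> //; apply/seteqP; split=> // y _.
exact: ab.
Qed.

Theorem theorem5p4 (R : realType) (X : topologicalType) (c0 : cantor_space)
    (X_compact : compact [set: X])
    (X_metrizable : metrizable R X)
    (C1_dense : dense (one_point_components X))
    (C1_Gdelta : Gdelta (one_point_components X))
    (C1_interior : (one_point_components X)° !=set0)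
    (X_not_two_points : ~ exists a b : X, a <> b /\ [set: X] = [set a; b]) :
  [<-> ~ reconstructible X;
       constant_universal_sequence cantor_space X;
       isolated (one_point_components X)° = set0
         /\ dense (one_point_components X)°;
       compactification_of X [set~ c0]].
Proof.
have [M XM] := X_metrizable.
have mX : pseudometrizable R X by exists M.
have hX : hausdorff_space X.
  apply: hausdorff_homeomorphic (homeomorphic_sym XM) _.
  exact: metric_hausdorff.
have pcX : isolated (one_point_components X)° = set0 /\
    dense (one_point_components X)° -> perfect_compactum R X.
  by move=> [iU dU]; split=> //; exact: dense_perfect iU dU.
have [x _] := C1_interior.
tfae.
- move=> recX.
  apply: (not_reconstructible_constant_universal_sequence X_compact hX mX) => //.
  exact: not_reconstructible_three_points recX.
- exact: constant_universal_sequence_dense.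
- by move=> /[dup]/pcX pX [_ dU]; exact: (dense_compactification c0 pX).
- move=> /compactification_dense/[dup]/pcX pX [_ dU].
  exact: (dense_not_reconstructible pX).
Qed.
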